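(* Assume $\partial^s(P)=\partial^w(P)$. For any $(\bm{x},\bm{y})\in T_{\mathrm{VRS\text{-}TO}}$, let $I^+(\bm{x})=\{i\in\{1,\dots,m\}: x_i>0\}$ and $I^+(\bm{y})=\{r\in\{1,\dots,s\}: y_r>0\}$, and let $$\phi^*:=\min_{r\in I^+(\bm{y})}\max\{\phi_r:\ (\bm{x},\bm\phi\otimes\bm{y})\in T_{\mathrm{VRS\text{-}TO}},\ \phi_q=1\ \forall q\ne r\},$$ $$\theta^*:=\begin{cases}1/\phi^* & \text{if } I^+(\bm{x})=\emptyset,\\ \displaystyle\max_{i\in I^+(\bm{x})}\min\{\theta_i:\ (\bm\theta\otimes\bm{x},\bm{y})\in T_{\mathrm{VRS\text{-}TO}},\ \theta_q=1\ \forall q\ne i\} & \text{otherwise.}\end{cases}$$ Then $$\hat F(\bm{x},\bm{y};T_{\mathrm{VRS\text{-}TO}})=\max\left\{\frac{m+s-1+\theta^*}{m+s},\ \frac{m+s-1+1/\phi^*}{m+s}\right\}.$$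
   Context: Vector inequalities are componentwise ($>$ means strict in every component). $\mathbb{R}^D_+$ is the nonnegative orthant and $\bar{\mathbb{R}}^D_+=\mathbb{R}^D_+\setminus\{\bm 0\}$. Data: positive integers $m,s,n,K$; vectors $(\bm{x}_j,\bm{y}_j)\in\bar{\mathbb{R}}^m_+\times\bar{\mathbb{R}}^s_+$ for $j=1,\dots,n$ (observed input and output vectors); and arbitrary trade-off vectors $(\bm{r}^-_t,\bm{r}^+_t)\in\mathbb{R}^m\times\mathbb{R}^s$ for $t=1,\dots,K$. Define $$P=\Big\{(\bm{x},\bm{y})\in\mathbb{R}^m\times\mathbb{R}^s:\ \exists \lambda_1,\dots,\lambda_n\ge0,\ \pi_1,\dots,\pi_K\ge0,\ \sum_{j}\lambda_j=1,\ \sum_{j}\lambda_j\bm{x}_j+\sum_t\pi_t\bm{r}^-_t\le\bm{x},\ \sum_j\lambda_j\bm{y}_j+\sum_t\pi_t\bm{r}^+_t\ge\bm{y}\Big\},$$ and the production possibility set $T_{\mathrm{VRS\text{-}TO}}=P\cap(\mathbb{R}^m_+\times\bar{\mathbb{R}}^s_+)$. It is assumed that $P\ne\mathbb{R}^{m}\times\mathbb{R}^s$ (so that $P$ has at least one facet). For a set $S\subseteq\mathbb{R}^m\times\mathbb{R}^s$ (used for $S=P$ and $S=T_{\mathrm{VRS\text{-}TO}}$), the strongly and weakly efficient frontiers are $\partial^s(S)=\{(\bm{x},\bm{y})\in S:\ (\bm{x},-\bm{y})\ge(\bm{x}',-\bm{y}')\text{ and }(\bm{x},-\bm{y})\ne(\bm{x}',-\bm{y}')\text{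 imply }(\bm{x}',\bm{y}')\notin S\}$ and $\partial^w(S)=\{(\bm{x},\bm{y})\in S:\ (\bm{x},-\bm{y})>(\bm{x}',-\bm{y}')\text{ implies }(\bm{x}',\bm{y}')\notin S\}$. For $\bm\theta\in\mathbb{R}^m,\bm\phi\in\mathbb{R}^s$ write $\bm\theta\otimes\bm{x}=(\theta_1x_1,\dots,\theta_mx_m)$, $\bm\phi\otimes\bm{y}=(\phi_1y_1,\dots,\phi_sy_s)$, and $f(\bm\theta,\bm\phi)=\frac1{m+s}\big(\sum_{i=1}^m\theta_i+\sum_{r=1}^s\frac1{\phi_r}\big)$. For $(\bm{x},\bm{y})\in T_{\mathrm{VRS\text{-}TO}}$, the extended max Russell graph measure $\hat F(\bm{x},\bm{y};T_{\mathrm{VRS\text{-}TO}})$ is the optimal value of $$\max\{f(\bm\theta,\bm\phi):\ (\bm\theta\otimes\bm{x},\bm\phi\otimes\bm{y})\in\partial^s(T_{\mathrm{VRS\text{-}TO}}),\ 0\le\theta_i\le1\ (i=1,\dots,m),\ \phi_r\ge1\ (r=1,\dots,s)\}.$$ *)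

(* Defs.v *)
From HB Require Import structures.
From mathcomp Require Import all_boot all_order all_algebra.
From mathcomp Require Import boolp classical_sets reals.

Set Implicit Arguments.
Unset Strict Implicit.
Unset Printing Implicit Defensive.

Import Order.TTheory GRing.Theory Num.Theory.

Local Open Scope classical_set_scope.
Local Open Scope ring_scope.

Section Vectors.
Variable R : realType.

Definition vle d (u v : 'rV[R]_d) : Prop := forall i, u 0 i <= v 0 i.
Definition vlt d (u v : 'rV[R]_d) : Prop := forall i, u 0 i < v 0 i.

Definition nonneg d (u : 'rV[R]_d) : Prop := vle 0 u.
Definition semipos d (u : 'rV[R]_d) : Prop := nonneg u /\ u <> 0.

Definition hprod d (u v : 'rV[R]_d) : 'rV[R]_d := \row_i (u 0 i * v 0 i).

Definition pos_support d (u : 'rV[R]_d) : set 'I_d := [set i | 0 < u 0 i].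

Definition is_max (A : set R) (v : R) : Prop := A v /\ ubound A v.
Definition is_min (A : set R) (v : R) : Prop := A v /\ lbound A v.

Lemma is_max_unique (A : set R) (v w : R) : is_max A v -> is_max A w -> v = w.
Proof.
move=> [Av ubv] [Aw ubw]; apply/eqP; rewrite eq_le.
by apply/andP; split; [apply: ubw | apply: ubv].
Qed.

Lemma is_min_unique (A : set R) (v w : R) : is_min A v -> is_min A w -> v = w.
Proof.
move=> [Av lbv] [Aw lbw]; apply/eqP; rewrite eq_le.
by apply/andP; split; [apply: lbv | apply: lbw].
Qed.

End Vectors.

Section Technology.
Variables (R : realType) (m s n K : nat).
Variables (X : 'I_n -> 'rV[R]_m) (Y : 'I_n -> 'rV[R]_s).
Variables (rminus : 'I_K -> 'rV[R]_m) (rplus : 'I_K -> 'rV[R]_s).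

Definition tradeoff_polyhedron : set ('rV[R]_m * 'rV[R]_s) :=
  [set p | exists (lam : 'I_n -> R) (pi : 'I_K -> R),
    [/\ forall j, 0 <= lam j,
        forall t, 0 <= pi t,
        \sum_j lam j = 1,
        vle (\sum_j lam j *: X j + \sum_t pi t *: rminus t) p.1 &
        vle p.2 (\sum_j lam j *: Y j + \sum_t pi t *: rplus t)]].

Definition vrs_to : set ('rV[R]_m * 'rV[R]_s) :=
  tradeoff_polyhedron `&` [set p | nonneg p.1 /\ semipos p.2].

End Technology.

Section Frontiers.
Variables (R : realType) (m s : nat).
Implicit Types (S : set ('rV[R]_m * 'rV[R]_s)) (p : 'rV[R]_m * 'rV[R]_s).

(* (x, y) is encoded as the vector (x, -y) of R^(m+s), so that smaller is
   better in every component. *)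
Definition netted p : 'rV[R]_(m + s) := row_mx p.1 (- p.2).

Definition strong_frontier S : set ('rV[R]_m * 'rV[R]_s) :=
  [set p | S p /\
    forall p', vle (netted p') (netted p) -> netted p <> netted p' -> ~ S p'].

Definition weak_frontier S : set ('rV[R]_m * 'rV[R]_s) :=
  [set p | S p /\ forall p', vlt (netted p') (netted p) -> ~ S p'].

End Frontiers.

Section RussellMeasure.
Variables (R : realType) (m s : nat).
Variable T : set ('rV[R]_m * 'rV[R]_s).
Variables (x : 'rV[R]_m) (y : 'rV[R]_s).

Definition russell_obj (theta : 'rV[R]_m) (phi : 'rV[R]_s) : R :=
  (m + s)%:R^-1 * (\sum_i theta 0 i + \sum_r (phi 0 r)^-1).

Definition max_russell_values : set R :=
  [set v | exists (theta : 'rV[R]_m) (phi : 'rV[R]_s),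
    [/\ strong_frontier T (hprod theta x, hprod phi y),
        forall i, 0 <= theta 0 i <= 1,
        forall r, 1 <= phi 0 r &
        v = russell_obj theta phi]].

Definition is_max_russell (v : R) : Prop := is_max max_russell_values v.

Definition output_expansions (r : 'I_s) : set R :=
  [set v | exists phi : 'rV[R]_s,
    [/\ T (x, hprod phi y), forall q, q != r -> phi 0 q = 1 & v = phi 0 r]].

Definition input_contractions (i : 'I_m) : set R :=
  [set v | exists theta : 'rV[R]_m,
    [/\ T (hprod theta x, y), forall q, q != i -> theta 0 q = 1
      & v = theta 0 i]].

Definition is_phi_star (phistar : R) : Prop :=
  exists g : 'I_s -> R,
    (forall r, pos_support y r -> is_max (output_expansions r) (g r)) /\
    is_min (g @` pos_support y) phistar.

Definition is_theta_star (phistar thetastar : R) : Prop :=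
  if `[< pos_support x = set0 >] then thetastar = phistar^-1
  else exists g : 'I_m -> R,
    (forall i, pos_support x i -> is_min (input_contractions i) (g i)) /\
    is_max (g @` pos_support x) thetastar.

Lemma is_phi_star_unique (a b : R) : is_phi_star a -> is_phi_star b -> a = b.
Proof.
move=> [g [gmax amin]] [h [hmax bmin]]; apply: is_min_unique amin _.
suff -> : g @` pos_support y = h @` pos_support y by [].
by apply: eq_imagel => r yr; apply: is_max_unique (gmax r yr) (hmax r yr).
Qed.

Lemma is_theta_star_unique (c a b : R) :
  is_theta_star c a -> is_theta_star c b -> a = b.
Proof.
rewrite /is_theta_star; case: ifP => _; first by move=> -> ->.
move=> [g [gmin amax]] [h [hmin bmax]]; apply: is_max_unique amax _.
suff -> : g @` pos_support x = h @` pos_support x by [].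
by apply: eq_imagel => i xi; apply: is_min_unique (gmin i xi) (hmin i xi).
Qed.

End RussellMeasure.

(* Main.v *)
Require Import Defs.
From mathcomp Require Import all_boot all_order all_algebra.
From mathcomp Require Import boolp classical_sets reals.
From mathcomp Require Import ring lra.

Import Order.TTheory GRing.Theory Num.Theory.

Local Open Scope classical_set_scope.
Local Open Scope ring_scope.

(** Write P for the trade-off polyhedron and T for its part with nonnegative
inputs and semipositive outputs. Raising outputs within P never leaves T, so a
strongly efficient point of T cannot be strictly dominated in P, and since the
two frontiers of P agree, the converse holds for points of T: the strong
frontier of T is the part of the weak frontier of P that lies in T
([strong_frontier_vrs_to], [weak_frontier_vrs_to]). The Russell objective is
1 - S / (m + s), where S is the total defect: the sum of all 1 - theta_i and
1 - 1 / phi_r. The question is thus how small S can be when (x, y) is moved to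
the boundary of P.

Moving one coordinate as far as possible reaches the boundary, which makes
1 - theta* and 1 - 1 / phi* attainable. The exception is an input that can be
shrunk all the way to 0 while still inside P, but then its defect is 1, and
1 - 1 / phi* is smaller.

That nothing is cheaper is a convexity argument ([single_moves_bound]). Let M
be the smaller of the two defects. Moving any single coordinate with defect M
stays in P. If S < M, weigh these moves by the defects of (theta, phi) divided
by M. The weights add up to S / M < 1, so their combination, with the remaining
weight put on a point of P strictly better than (x, y), is in P. The input
moves add up exactly to theta; for outputs, phi - 1 is a convex function of the
defect 1 - 1 / phi, so the combination overshoots phi. Hence (theta x, phi y) is
strictly dominated and is not on the boundary.

The extrema that define phi* and theta* exist for two reasons. Lines meet P in
closed sets: Fourier-Motzkin elimination turns the existence of multipliers
into finitely many affine inequalities in the parameter of the line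
([slice_has_max]). And no output can grow without bound
([improving_direction_bounded]): by closedness the growth direction could be
followed from every point of P, in particular from a weakly efficient one,
which would then fail to be strongly efficient. *)

(** * Fourier-Motzkin elimination *)

(** The right-hand sides left after eliminating u from the system
[a j * u <= f j]: a row that does not involve u is kept, and each pair of an
upper bound (row j) and a lower bound (row l) gives one row. The trivial row 0
stands in for all other indices, which keeps the index type independent
of a. *)
Definition fm_elim {R : realType} {J : finType} (a f : J -> R)
    (k : J + J * J) : R :=
  match k with
  | inl j => if a j == 0 then f j else 0
  | inr (j, l) => if (0 < a j) && (a l < 0) then a j * f l - a l * f j else 0
  end.

Lemma fm_elim_linear {R : realType} {J : finType} (a : J -> R) (b : R)
    (f g : J -> R) :
  fm_elim a (fun j => b * f j + g j)
  = (fun k => b * fm_elim a f k + fm_elim a g k).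
Proof.
apply/funext => -[j|[j l]] /=; case: ifP => _; ring.
Qed.

Lemma fm_elim_sum {R : realType} {I J : finType} (a : J -> R) (r : seq I)
    (c : J -> I -> R) (v : I -> R) (k : J + J * J) :
  fm_elim a (fun j => \sum_(i <- r) c j i * v i) k
  = \sum_(i <- r) fm_elim a (c^~ i) k * v i.
Proof.
case: k => [j|[j l]] /=; case: ifP => _ //.
- by rewrite big1 // => i _; rewrite mul0r.
- rewrite !mulr_sumr -sumrB; apply: eq_bigr => i _; ring.
- by rewrite big1 // => i _; rewrite mul0r.
Qed.

(** Each lower bound on u is below each upper bound, so the largest lower bound
is a solution; without lower bounds, the smallest upper bound is one. *)
Lemma fm_elimP {R : realType} {J : finType} (a f : J -> R) :
  (exists u, forall j, a j * u <= f j) <-> (forall k, 0 <= fm_elim a f k).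
Proof.
split=> [[u au] [j|[j l]] /=|f_ge0].
- by case: ifP => // /eqP aj0; have := au j; rewrite aj0 mul0r.
- case: ifP => // /andP[aj al]; have := au j; have := au l => ul uj; nra.
have f0 j : a j = 0 -> 0 <= f j.
  by move=> aj0; have := f_ge0 (inl j); rewrite /= aj0 eqxx.
have fpn j l : 0 < a j -> a l < 0 -> f l / a l <= f j / a j.
  move=> aj al; have := f_ge0 (inr (j, l)); rewrite /= aj al /= => h.
  rewrite ler_ndivrMr // mulrAC ler_pdivrMr //; lra.
have upper u j : 0 < a j -> (a j * u <= f j) = (u <= f j / a j).
  by move=> aj; rewrite ler_pdivlMr // mulrC.
have lower u j : a j < 0 -> (a j * u <= f j) = (f j / a j <= u).
  by move=> aj; rewrite ler_ndivrMr // mulrC.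
case: (pselect (exists l, a l < 0)) => [[l0 al0]|noneg].
  have [l al lmax] :=
    @arg_maxP _ _ _ l0 (fun l => a l < 0) (fun l => f l / a l) al0.
  exists (f l / a l) => j.
  case: (ltgtP (a j) 0) => [aj|aj|aj].
  - by rewrite lower //; exact: lmax.
  - by rewrite upper //; exact: fpn.
  - by rewrite aj mul0r f0.
case: (pselect (exists j, 0 < a j)) => [[j0 aj0]|nopos].
  have [l al lmin] :=
    @arg_minP _ _ _ j0 (fun j => 0 < a j) (fun l => f l / a l) aj0.
  exists (f l / a l) => j.
  case: (ltgtP (a j) 0) => [aj|aj|aj].
  - by case: noneg; exists j.
  - by rewrite upper //; exact: lmin.
  - by rewrite aj mul0r f0.
exists 0 => j; rewrite mulr0; apply: f0.
case: (ltgtP (a j) 0) => // aj; first by case: noneg; exists j.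
by case: nopos; exists j.
Qed.

(** One variable is eliminated for each element of r. The map Phi takes the
right-hand sides of the system to those of the variable-free system; its
linearity is what makes a right-hand side that is affine in a parameter give
conditions that are affine in it. *)
Lemma linear_system_solvable_seq {R : realType} {I : finType} (r : seq I) :
  uniq r -> forall (J : finType) (c : J -> I -> R),
  exists (J' : finType) (Phi : (J -> R) -> J' -> R),
    (forall b f g k, Phi (fun j => b * f j + g j) k = b * Phi f k + Phi g k) /\
    (forall g, (exists v, forall j, \sum_(i <- r) c j i * v i <= g j) <->
               (forall k, 0 <= Phi g k)).
Proof.
elim: r => [_|i r IH /= /andP[ir ur]] J c.
  exists J, id; split=> // g; split=> [[v gv] k|g0].
    by have := gv k; rewrite big_nil.
  by exists (fun=> 0) => j; rewrite big_nil.
pose a := c^~ i.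
have [J' [Phi [lin Phi_solv]]] := IH ur _ (fun k i' => fm_elim a (c^~ i') k).
exists J', (fun g => Phi (fm_elim a g)); split=> [b f g k|g].
  by rewrite fm_elim_linear lin.
rewrite -Phi_solv.
(* The row sums without variable i: the residual g - sr v has to bound a u. *)
pose sr v j := \sum_(i' <- r) c j i' * v i'.
have resid v : (exists u, forall j, a j * u <= -1 * sr v j + g j) <->
    (forall k, \sum_(i' <- r) fm_elim a (c^~ i') k * v i' <= fm_elim a g k).
  rewrite fm_elimP fm_elim_linear.
  by split=> h k; have := h k; rewrite fm_elim_sum; lra.
split=> [[v gv]|[v /resid [u gu]]].
  exists v; apply/resid; exists (v i) => j.
  by have := gv j; rewrite big_cons /sr /a; lra.
exists (fun i' => if i' == i then u else v i') => j.
rewrite big_cons eqxx.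
have -> : \sum_(i' <- r) c j i' * (if i' == i then u else v i') = sr v j.
  rewrite /sr !big_seq; apply: eq_bigr => i' i'r; case: eqP => // ii'.
  by move: ir; rewrite -ii' i'r.
by have := gu j; rewrite /a; lra.
Qed.

Lemma linear_system_solvable {R : realType} {I J : finType} (c : J -> I -> R) :
  exists (J' : finType) (Phi : (J -> R) -> J' -> R),
    (forall b f g k, Phi (fun j => b * f j + g j) k = b * Phi f k + Phi g k) /\
    (forall g, (exists v, forall j, \sum_i c j i * v i <= g j) <->
               (forall k, 0 <= Phi g k)).
Proof. exact: linear_system_solvable_seq (index_enum_uniq I) J c. Qed.

(** The solution set is closed: a row that failed at the supremum would also
fail just below it if its slope is negative, and at every smaller point if
not. *)
Lemma affine_system_has_max {R : realType} {J : finType} (a b : J -> R)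
    (h0 B : R) :
  let H := [set h | forall j, 0 <= h * a j + b j] in
  H h0 -> ubound H B -> exists h, is_max H h.
Proof.
move=> H Hh0 HB.
have hasH : has_sup H by split; [exists h0 | exists B].
have subH : ubound H (sup H) by exact: sup_upper_bound.
exists (sup H); split=> // j; rewrite leNgt; apply/negP => neg.
case: (lerP 0 (a j)) => aj.
  by have := Hh0 j; have := subH _ Hh0; nra.
(* Row j holds only up to sup H - e. *)
pose e := (sup H * a j + b j) / a j.
have ee : e * a j = sup H * a j + b j by rewrite /e divfK // lt_eqF.
have e0 : 0 < e by rewrite /e nmulr_rgt0 // invr_lt0.
have [h Hh hsup] := sup_adherent e0 hasH.
by have := Hh j; nra.
Qed.

(** * Dominance and frontiers *)

Lemma common_positive_bound {R : realType} {I : finType} (f : I -> R) :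
  (forall i, 0 < f i) -> exists2 e, 0 < e & forall i, e <= f i.
Proof.
move=> f0; case: (pickP (@predT I)) => [i0 _|I0]; last first.
  by exists 1 => // i; have := I0 i.
have [i _ imin] := @arg_minP _ _ _ i0 predT f isT.
by exists (f i) => // j; exact: imin.
Qed.

Lemma vle_trans {R : realType} {d : nat} (v u w : 'rV[R]_d) :
  vle u v -> vle v w -> vle u w.
Proof. by move=> uv vw i; exact: le_trans (uv i) (vw i). Qed.

Lemma vle_netted {R : realType} {m s : nat} (q p : 'rV[R]_m * 'rV[R]_s) :
  vle (netted q) (netted p) <-> vle q.1 p.1 /\ vle p.2 q.2.
Proof.
split=> [qp|[qp1 qp2] k].
  split=> i; first by have := qp (lshift s i); rewrite /netted !row_mxEl.
  by have := qp (rshift m i); rewrite /netted !row_mxEr !mxE lerN2.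
case: (split_ordP k) => i ->; rewrite /netted ?row_mxEl ?row_mxEr.
  exact: qp1.
by rewrite !mxE lerN2; exact: qp2.
Qed.

Lemma vlt_netted {R : realType} {m s : nat} (q p : 'rV[R]_m * 'rV[R]_s) :
  vlt (netted q) (netted p) <-> vlt q.1 p.1 /\ vlt p.2 q.2.
Proof.
split=> [qp|[qp1 qp2] k].
  split=> i; first by have := qp (lshift s i); rewrite /netted !row_mxEl.
  by have := qp (rshift m i); rewrite /netted !row_mxEr !mxE ltrN2.
case: (split_ordP k) => i ->; rewrite /netted ?row_mxEl ?row_mxEr.
  exact: qp1.
by rewrite !mxE ltrN2; exact: qp2.
Qed.

Lemma netted_inj {R : realType} {m s : nat} : injective (@netted R m s).
Proof.
by move=> [q1 q2] [p1 p2] /eq_row_mx[/= -> /oppr_inj ->].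
Qed.

Lemma strong_frontier_undominated {R : realType} {m s : nat}
    (S : set ('rV[R]_m * 'rV[R]_s)) p q :
  strong_frontier S p -> S q -> vle q.1 p.1 -> vle p.2 q.2 -> q = p.
Proof.
move=> [_ pS] Sq q1 q2; apply: contrapT => qp.
by apply: (pS q) Sq; [apply/vle_netted | move/netted_inj/esym].
Qed.

Lemma weak_frontier_undominated {R : realType} {m s : nat}
    (S : set ('rV[R]_m * 'rV[R]_s)) p :
  S p -> (forall q, S q -> vlt q.1 p.1 -> vlt p.2 q.2 -> False) ->
  weak_frontier S p.
Proof.
by move=> Sp pS; split=> // q /vlt_netted[q1 q2] Sq; exact: pS q1 q2.
Qed.

Lemma not_weak_frontier {R : realType} {m s : nat}
    (S : set ('rV[R]_m * 'rV[R]_s)) p :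
  S p -> ~ weak_frontier S p -> exists q, [/\ S q, vlt q.1 p.1 & vlt p.2 q.2].
Proof.
move=> Sp nw; apply: contrapT => nq; apply/nw/weak_frontier_undominated => //.
by move=> q Sq q1 q2; apply: nq; exists q.
Qed.

(** * The trade-off polyhedron *)

Section Polyhedron.
Context {R : realType} {m s n K : nat}.
Variables (X : 'I_n -> 'rV[R]_m) (Y : 'I_n -> 'rV[R]_s).
Variables (rminus : 'I_K -> 'rV[R]_m) (rplus : 'I_K -> 'rV[R]_s).
Let point := ('rV[R]_m * 'rV[R]_s)%type.
Let P : set point := tradeoff_polyhedron X Y rminus rplus.

(** The system of inequalities in the multipliers (lam, pi) that expresses
membership in the polyhedron. The rows are: the sign of each multiplier, the
normalization of lam as two opposite inequalities, the inputs, the outputs. *)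
Definition membership_coef (j : ('I_n + 'I_K) + bool + ('I_m + 'I_s))
    (k : 'I_n + 'I_K) : R :=
  match j, k with
  | inl (inl k'), _ => - (k' == k)%:R
  | inl (inr b), inl _ => (-1) ^+ b
  | inl (inr b), inr _ => 0
  | inr (inl i), inl j => X j 0 i
  | inr (inl i), inr t => rminus t 0 i
  | inr (inr r), inl j => - Y j 0 r
  | inr (inr r), inr t => - rplus t 0 r
  end.

(** The total weight e of lam is a parameter so that a direction can be given
weight 0: the right-hand side for [p + h *: d] is then affine in h. *)
Definition membership_rhs (e : R) (p : point)
    (j : ('I_n + 'I_K) + bool + ('I_m + 'I_s)) : R :=
  match j with
  | inl (inl k') => 0
  | inl (inr b) => (-1) ^+ b * e
  | inr (inl i) => p.1 0 i
  | inr (inr r) => - p.2 0 r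
  end.

Lemma polyhedronE p :
  P p <-> exists v, forall j,
    \sum_k membership_coef j k * v k <= membership_rhs 1 p j.
Proof.
have diag k v : \sum_k' membership_coef (inl (inl k)) k' * v k' = - v k.
  rewrite (bigD1 k) //= eqxx big1 => [|k' /negPf k'k].
    by rewrite mulr1n; ring.
  by rewrite eq_sym k'k mulr0n; ring.
have tot b (v : 'I_n + 'I_K -> R) : \sum_k membership_coef (inl (inr b)) k * v k
    = (-1) ^+ b * \sum_j v (inl j).
  rewrite big_sumType /= [X in _ + X]big1 ?addr0 ?mulr_sumr //.
  by move=> t _; rewrite mul0r.
have inp i (v : 'I_n + 'I_K -> R) : \sum_k membership_coef (inr (inl i)) k * v k
    = (\sum_j v (inl j) *: X j + \sum_t v (inr t) *: rminus t) 0 i.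
  rewrite big_sumType /= mxE !summxE.
  by congr (_ + _); apply: eq_bigr => j _; rewrite mxE mulrC.
have out r (v : 'I_n + 'I_K -> R) : \sum_k membership_coef (inr (inr r)) k * v k
    = - (\sum_j v (inl j) *: Y j + \sum_t v (inr t) *: rplus t) 0 r.
  rewrite big_sumType /= mxE !summxE opprD -!sumrN.
  by congr (_ + _); apply: eq_bigr => j _; rewrite mxE mulrC mulrN.
split=> [[lam [pi [lam0 pi0 lam1 px py]]]|[v vP]].
  pose v k := match k with inl j => lam j | inr t => pi t end.
  exists v => -[[k|b]|[i|r]].
  - by rewrite diag /= oppr_le0; case: k.
  - by rewrite tot /= lam1.
  - by rewrite inp; exact: px.
  - by rewrite out lerN2; exact: py.
exists (v \o inl), (v \o inr); split=> [j|t||i|r] /=.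
- by have := vP (inl (inl (inl j))); rewrite diag /= oppr_le0.
- by have := vP (inl (inl (inr t))); rewrite diag /= oppr_le0.
- have := vP (inl (inr false)); have := vP (inl (inr true)).
  rewrite !tot /= expr0 expr1 => h1 h2.
  by apply/eqP; rewrite eq_le; apply/andP; split; lra.
- by have := vP (inr (inl i)); rewrite inp.
- by have := vP (inr (inr r)); rewrite out lerN2.
Qed.

Lemma membership_rhs_affine h (p d : point) :
  (fun j => h * membership_rhs 0 d j + membership_rhs 1 p j)
  = membership_rhs 1 (p + h *: d).
Proof.
case: p d => px py [dx dy].
by apply/funext => -[[k|b]|[i|r]] /=; rewrite ?mxE; ring.
Qed.

(** A line meets the polyhedron in the solution set of finitely many affine
inequalities, so a bounded slice contains its supremum. *)
Lemma slice_has_max (p d : point) (h0 B : R) :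
  P (p + h0 *: d) -> ubound [set h | P (p + h *: d)] B ->
  exists h, is_max [set h | P (p + h *: d)] h.
Proof.
have [J' [Phi [lin Phi_solv]]] := linear_system_solvable membership_coef.
have -> : [set h | P (p + h *: d)] =
    [set h | forall k,
      0 <= h * Phi (membership_rhs 0 d) k + Phi (membership_rhs 1 p) k].
  apply/predeqP => h; split=> [/polyhedronE/Phi_solv Ph k|Ph].
    by rewrite -lin membership_rhs_affine.
  apply/polyhedronE/Phi_solv => k; rewrite -membership_rhs_affine lin.
  exact: Ph.
move=> /polyhedronE/Phi_solv; rewrite -membership_rhs_affine => Ph0.
by apply: (@affine_system_has_max _ _ _ _ h0) => k; rewrite -lin.
Qed.

Lemma free_disposal (q p : point) :
  P q -> vle q.1 p.1 -> vle p.2 q.2 -> P p.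
Proof.
move=> [lam [pi [lam0 pi0 lam1 qx qy]]] qp1 qp2; exists lam, pi; split=> //.
  exact: vle_trans qx qp1.
exact: vle_trans qp2 qy.
Qed.

(** The homogenization of the polyhedron, which is its slice at t = 1. Being
closed under sums and nonnegative scaling, it turns a convex combination of
many points into a plain iterated sum. *)
Definition polyhedron_cone (t : R) : set point :=
  [set p | exists (lam : 'I_n -> R) (pi : 'I_K -> R),
    [/\ forall j, 0 <= lam j,
        forall t, 0 <= pi t,
        \sum_j lam j = t,
        vle (\sum_j lam j *: X j + \sum_t pi t *: rminus t) p.1 &
        vle p.2 (\sum_j lam j *: Y j + \sum_t pi t *: rplus t)]].

Lemma polyhedron_cone0 : polyhedron_cone 0 0.
Proof.
exists (fun=> 0), (fun=> 0); split=> //; first by rewrite big1.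
  by move=> i; rewrite !big1 ?addr0 // => k _; rewrite scale0r.
by move=> i; rewrite !big1 ?addr0 // => k _; rewrite scale0r.
Qed.

Lemma polyhedron_coneD t u p q :
  polyhedron_cone t p -> polyhedron_cone u q -> polyhedron_cone (t + u) (p + q).
Proof.
move=> [lam [pi [lam0 pi0 lam1 px py]]] [lam' [pi' [lam'0 pi'0 lam'1 qx qy]]].
have sumD (d I : nat) (a b : 'I_I -> R) (v : 'I_I -> 'rV[R]_d) :
    \sum_k (a k + b k) *: v k = \sum_k a k *: v k + \sum_k b k *: v k.
  by rewrite -big_split; apply: eq_bigr => k _; rewrite scalerDl.
exists (fun j => lam j + lam' j), (fun k => pi k + pi' k); split.
- by move=> j; rewrite addr_ge0.
- by move=> k; rewrite addr_ge0.
- by rewrite big_split /= lam1 lam'1.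
- by move=> i; rewrite !sumD addrACA mxE [leRHS]mxE lerD ?px ?qx.
- by move=> r; rewrite !sumD addrACA mxE [leRHS]mxE lerD ?py ?qy.
Qed.

Lemma polyhedron_coneZ w t p :
  0 <= w -> polyhedron_cone t p -> polyhedron_cone (w * t) (w *: p).
Proof.
move=> w0 [lam [pi [lam0 pi0 lam1 px py]]].
have sumZ (d I : nat) (a : 'I_I -> R) (v : 'I_I -> 'rV[R]_d) :
    \sum_k (w * a k) *: v k = w *: \sum_k a k *: v k.
  by rewrite scaler_sumr; apply: eq_bigr => k _; rewrite scalerA.
exists (fun j => w * lam j), (fun k => w * pi k); split.
- by move=> j; rewrite mulr_ge0.
- by move=> k; rewrite mulr_ge0.
- by rewrite -mulr_sumr lam1.
- by move=> i; rewrite !sumZ -scalerDr mxE [leRHS]mxE ler_wpM2l ?px.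
- by move=> r; rewrite !sumZ -scalerDr mxE [leRHS]mxE ler_wpM2l ?py.
Qed.

Lemma convex_combination {I : finType} (w : I -> R) (p : point)
    (q : I -> point) :
  (forall k, 0 <= w k) -> \sum_k w k <= 1 -> P p -> (forall k, P (q k)) ->
  P ((1 - \sum_k w k) *: p + \sum_k w k *: q k).
Proof.
move=> w0 w1 Pp Pq; have PE z : P z = polyhedron_cone 1 z by [].
rewrite PE -{1}[1](subrK (\sum_k w k)); apply: polyhedron_coneD.
  by rewrite -[X in polyhedron_cone X]mulr1; apply: polyhedron_coneZ => //;
     rewrite subr_ge0.
apply: (big_ind2 polyhedron_cone) => [|t z u z' ? ?|k _].
- exact: polyhedron_cone0.
- exact: polyhedron_coneD.
- rewrite -[X in polyhedron_cone X]mulr1.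
  exact: polyhedron_coneZ (w0 k) (Pq k).
Qed.

Lemma convex_segment t (p q : point) :
  0 <= t <= 1 -> P p -> P q -> P ((1 - t) *: p + t *: q).
Proof.
move=> /andP[t0 t1] Pp Pq.
have := @convex_combination 'I_1 (fun=> t) p (fun=> q).
by rewrite !big_ord1; exact.
Qed.

Definition unit_improvement : point := (const_mx (-1), const_mx 1).

(** Any point is dominated by p improved sufficiently often, so unbounded
improvement would make everything feasible. *)
Lemma uniform_improvement_bounded (p : point) :
  P <> setT -> exists B, ubound [set h | P (p + h *: unit_improvement)] B.
Proof.
move=> Pproper; apply: contrapT => unb; apply: Pproper.
apply/seteqP; split=> // -[zx zy] _.
case: p unb => px py unb.
have big B : exists2 h, B < h & P ((px, py) + h *: unit_improvement).
  apply: contrapT => nB; apply: unb; exists B => h Ph.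
  by rewrite leNgt; apply/negP => Bh; apply: nB; exists h.
have [h Bh Ph] := big (\sum_i `|zx 0 i - px 0 i| + \sum_r `|zy 0 r - py 0 r|).
have hx i : px 0 i - zx 0 i <= h.
  have le_i : `|zx 0 i - px 0 i| <= \sum_i `|zx 0 i - px 0 i|.
    by rewrite (bigD1 i) //= lerDl sumr_ge0.
  have : 0 <= \sum_r `|zy 0 r - py 0 r| by rewrite sumr_ge0.
  have := ler_norm (px 0 i - zx 0 i); rewrite distrC; lra.
have hy r : zy 0 r - py 0 r <= h.
  have le_r : `|zy 0 r - py 0 r| <= \sum_r `|zy 0 r - py 0 r|.
    by rewrite (bigD1 r) //= lerDl sumr_ge0.
  have : 0 <= \sum_i `|zx 0 i - px 0 i| by rewrite sumr_ge0.
  have := ler_norm (zy 0 r - py 0 r); lra.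
apply: free_disposal Ph _ _ => k /=; rewrite !mxE.
  by have := hx k; lra.
by have := hy k; lra.
Qed.

Lemma uniform_improvement_has_max (p : point) :
  P <> setT -> P p ->
  exists h, is_max [set h | P (p + h *: unit_improvement)] h.
Proof.
move=> Pproper Pp; have [B HB] := uniform_improvement_bounded p Pproper.
by apply: (slice_has_max _ _ 0 _ _ HB); rewrite scale0r addr0.
Qed.

(** A point strictly better in every coordinate is better by a common margin,
which contradicts maximality. This produces weakly efficient points. *)
Lemma uniform_improvement_frontier (p : point) h :
  is_max [set h | P (p + h *: unit_improvement)] h ->
  weak_frontier P (p + h *: unit_improvement).
Proof.
case: p => px py [Ph hmax]; apply: weak_frontier_undominated => // q Pq q1 q2.
pose gap k := match k with
  | inl i => ((px, py) + h *: unit_improvement).1 0 i - q.1 0 i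
  | inr r => q.2 0 r - ((px, py) + h *: unit_improvement).2 0 r
  end.
have [|e e0 egap] := @common_positive_bound _ _ gap.
  by move=> [i|r]; rewrite subr_gt0; [exact: q1 | exact: q2].
suff : P ((px, py) + (h + e) *: unit_improvement) by move/hmax; lra.
apply: free_disposal Pq _ _ => k.
  by have := egap (inl k); rewrite /= !mxE; lra.
by have := egap (inr k); rewrite /= !mxE; lra.
Qed.

(** Closedness of P, approaching p from the dominated side. *)
Lemma mem_improvement_limit (p : point) :
  P <> setT -> (forall e, 0 < e -> P (p - e *: unit_improvement)) -> P p.
Proof.
move=> Pproper Pe; have [B HB] := uniform_improvement_bounded p Pproper.
have [||h [Ph hmax]] := slice_has_max p unit_improvement (-1) B.
- by rewrite scaleN1r -[unit_improvement]scale1r; exact: Pe.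
- exact: HB.
have h0 : 0 <= h.
  rewrite leNgt; apply/negP => h0.
  have : P (p + (h / 2) *: unit_improvement).
    by rewrite -[h / 2]opprK scaleNr; apply: Pe; lra.
  by move/hmax; lra.
case: p Pe HB Ph {hmax} => px py _ _ Ph.
by apply: free_disposal Ph _ _ => k; rewrite /= !mxE; lra.
Qed.

(** If d could be followed forever from p, then also from every point of P,
because P is closed and convex. Starting from a weakly efficient point w this
reaches [w + d], which dominates w; but w is also strongly efficient. *)
Lemma improving_direction_bounded (p d : point) :
  P <> setT -> strong_frontier P = weak_frontier P -> P p ->
  vle d.1 0 -> vle 0 d.2 -> d <> 0 ->
  exists B, ubound [set h | P (p + h *: d)] B.
Proof.
move=> Pproper front Pp d1 d2 d0; apply: contrapT => unb.
have ray h : P (p + h *: d).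
  have [h' hh' Ph'] : exists2 h', h < h' & P (p + h' *: d).
    apply: contrapT => nB; apply: unb; exists h => h' Ph'.
    by rewrite leNgt; apply/negP => hh'; apply: nB; exists h'.
  case: p d d1 d2 Ph' {Pp d0 unb} => px py [dx dy] /= d1 d2 Ph'.
  apply: free_disposal Ph' _ _ => k /=; rewrite !mxE.
    by have := d1 k; rewrite mxE; nra.
  by have := d2 k; rewrite mxE; nra.
have [c cmax] := uniform_improvement_has_max p Pproper Pp.
have c0 : 0 <= c by apply: cmax.2; rewrite /= scale0r addr0.
have := uniform_improvement_frontier p c cmax.
rewrite -front; set w := p + c *: unit_improvement => wP.
suff Pwd : P (w + d).
  have /(congr1 (fun z => z - w)) : w + d = w.
    apply: strong_frontier_undominated wP Pwd _ _.
      by case: (w) d d1 {d2 d0 unb ray} => wx wy [dx dy] /= d1 k;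
        rewrite !mxE; have := d1 k; rewrite mxE; lra.
    by case: (w) d d2 {d1 d0 unb ray} => wx wy [dx dy] /= d2 k;
        rewrite !mxE; have := d2 k; rewrite mxE; lra.
  by rewrite addrAC subrr add0r => /d0.
apply: mem_improvement_limit => // e e0.
(* Mixing w with a far point of the ray from p gives w + d, made worse by t * c
   improvements; this t keeps the loss t * c within e. *)
pose t := e / (c + e).
have ce0 : 0 < c + e by lra.
have t0 : 0 < t by rewrite divr_gt0.
have tce : t * (c + e) = e by rewrite divfK // gt_eqF.
have t01 : 0 <= t <= 1 by rewrite ltW //= /t ler_pdivrMr //; lra.
have := convex_segment t w (p + t^-1 *: d) t01 wP.1 (ray _).
rewrite [t *: (p + _)]scalerDr [t *: (t^-1 *: d)]scalerA divff ?gt_eqF //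
  scale1r.
have tce' : t * c <= e by nra.
rewrite /w; case: p d {unb ray d0 Pp cmax w wP} d1 d2.
move=> px py [dx dy] /= d1 d2 Pt.
by apply: free_disposal Pt _ _ => k; rewrite /= !mxE; lra.
Qed.

End Polyhedron.

(** * Rescaling coordinates *)

Definition scale_at {R : realType} {d : nat} (k : 'I_d) (c : R)
    (v : 'rV[R]_d) : 'rV[R]_d :=
  \row_i (if i == k then c * v 0 i else v 0 i).

Lemma hprod_scale_at {R : realType} {d : nat} (k : 'I_d) (a v : 'rV[R]_d) :
  (forall q, q != k -> a 0 q = 1) -> hprod a v = scale_at k (a 0 k) v.
Proof.
move=> a1; apply/rowP => i; rewrite !mxE.
by case: eqP => [->//|/eqP ik]; rewrite a1 // mul1r.
Qed.

Lemma scale_at1 {R : realType} {d : nat} (k : 'I_d) (v : 'rV[R]_d) :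
  scale_at k 1 v = v.
Proof. by apply/rowP => i; rewrite mxE mul1r if_same. Qed.

Lemma scale_at_slice {R : realType} {d : nat} (k : 'I_d) (h : R)
    (v : 'rV[R]_d) :
  v + h *: (v 0 k *: delta_mx 0 k) = scale_at k (1 + h) v.
Proof.
apply/rowP => i; rewrite !mxE eqxx /=.
by case: eqP => [->|_]; rewrite ?mulr1n ?mulr0n; ring.
Qed.

Lemma scale_at_le {R : realType} {d : nat} (k : 'I_d) (a b : R)
    (v : 'rV[R]_d) :
  nonneg v -> a <= b -> vle (scale_at k a v) (scale_at k b v).
Proof.
move=> v0 ab i; rewrite !mxE; case: eqP => // _.
by rewrite ler_wpM2r //; have := v0 i; rewrite mxE.
Qed.

Lemma scale_at_nonneg {R : realType} {d : nat} (k : 'I_d) (c : R)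
    (v : 'rV[R]_d) :
  nonneg v -> 0 <= c -> nonneg (scale_at k c v).
Proof.
move=> v0 c0 i; have := v0 i; rewrite !mxE => vi.
by case: eqP => // _; rewrite mulr_ge0.
Qed.

Lemma semipos_coordinate {R : realType} {d : nat} (v : 'rV[R]_d) :
  semipos v -> exists k, 0 < v 0 k.
Proof.
move=> [v0 vn0]; apply: contrapT => nk; apply/vn0/rowP => i.
have := v0 i; rewrite !mxE => vi; apply/eqP; rewrite eq_le vi andbT leNgt.
by apply/negP => vi0; apply: nk; exists i.
Qed.

Lemma semipos_of_coordinate {R : realType} {d : nat} (v : 'rV[R]_d) k :
  nonneg v -> 0 < v 0 k -> semipos v.
Proof. by move=> v0 vk; split=> // v00; move: vk; rewrite v00 mxE ltxx. Qed.

Definition factor_at {R : realType} {d : nat} (k : 'I_d) (c : R) : 'rV[R]_d :=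
  \row_i (if i == k then c else 1).

Lemma hprod_factor_at {R : realType} {d : nat} (k : 'I_d) (c : R)
    (v : 'rV[R]_d) :
  hprod (factor_at k c) v = scale_at k c v.
Proof.
rewrite (hprod_scale_at k) ?mxE ?eqxx // => q /negPf qk.
by rewrite mxE qk.
Qed.

Lemma hprod1 {R : realType} {d : nat} (v : 'rV[R]_d) :
  hprod (const_mx 1) v = v.
Proof. by apply/rowP => i; rewrite !mxE mul1r. Qed.

Lemma scale_at_null {R : realType} {d : nat} (k : 'I_d) (c : R)
    (v : 'rV[R]_d) :
  v 0 k = 0 -> scale_at k c v = v.
Proof.
move=> vk; apply/rowP => i; rewrite mxE; case: eqP => // ->.
by rewrite vk mulr0.
Qed.

(** * Efficiency in the production possibility set *)

Lemma weighted_sum_bump {R : realType} {I : finType} (w : I -> R) (a b : R)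
    (k0 : I) :
  \sum_k w k * (if k == k0 then b else a)
  = (\sum_k w k) * a + w k0 * (b - a).
Proof.
rewrite (bigD1 k0) //= eqxx [X in X * a](bigD1 k0) //=.
have -> : \sum_(k | k != k0) w k * (if k == k0 then b else a)
    = (\sum_(k | k != k0) w k) * a.
  by rewrite mulr_suml; apply: eq_bigr => k /negPf ->.
ring.
Qed.

Section Efficiency.
Context {R : realType} {m s n K : nat}.
Variables (X : 'I_n -> 'rV[R]_m) (Y : 'I_n -> 'rV[R]_s).
Variables (rminus : 'I_K -> 'rV[R]_m) (rplus : 'I_K -> 'rV[R]_s).
Let P : set ('rV[R]_m * 'rV[R]_s) := tradeoff_polyhedron X Y rminus rplus.
Let T : set ('rV[R]_m * 'rV[R]_s) := vrs_to X Y rminus rplus.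

(** If q strictly dominates p in P, giving p the outputs of q improves it
without changing the inputs, hence without leaving T. *)
Lemma strong_frontier_vrs_to p :
  (0 < s)%N -> strong_frontier T p -> weak_frontier P p.
Proof.
move=> s0 pT; have [Pp [p1 p2]] := pT.1.
apply: weak_frontier_undominated => // q Pq qp1 qp2.
have q2 : nonneg q.2 by move=> r; exact: le_trans (p2.1 r) (ltW (qp2 r)).
have Tq : T (p.1, q.2).
  split; first by apply: free_disposal Pq _ _ => // k; exact: ltW (qp1 k).
  split=> //=; apply: (@semipos_of_coordinate _ _ _ (Ordinal s0)) => //.
  by apply: le_lt_trans (qp2 _); have := p2.1 (Ordinal s0); rewrite mxE.
have qp : (p.1, q.2) = p.
  apply: strong_frontier_undominated pT Tq _ _ => // k; exact: ltW (qp2 k).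
by have := qp2 (Ordinal s0); rewrite -{1}qp /= ltxx.
Qed.

Lemma weak_frontier_vrs_to p :
  strong_frontier P = weak_frontier P -> T p -> weak_frontier P p ->
  strong_frontier T p.
Proof.
move=> front Tp; rewrite -front => -[_ pP]; split=> // q qp neq [Pq _];
  exact: pP Pq.
Qed.

(** The convexity argument. The moves of single coordinates with defect M are
combined with weights (defect of theta or phi) / M, and the remaining weight
goes to a point (x', y') of P strictly better than (x, y). If the total defect
were below M, that remaining weight would be positive and the combination would
strictly dominate (theta x, phi y). *)
Lemma single_moves_bound (M : R) (x : 'rV[R]_m) (y : 'rV[R]_s)
    (theta : 'rV[R]_m) (phi : 'rV[R]_s) :
  nonneg y -> 0 < M < 1 ->
  P (x, y) -> ~ weak_frontier P (x, y) ->
  (forall i, P (scale_at i (1 - M) x, y)) ->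
  (forall r, P (x, scale_at r (1 - M)^-1 y)) ->
  (forall i, theta 0 i <= 1) -> (forall r, 1 <= phi 0 r) ->
  weak_frontier P (hprod theta x, hprod phi y) ->
  M <= \sum_i (1 - theta 0 i) + \sum_r (1 - (phi 0 r)^-1).
Proof.
move=> y0 /andP[M0 M1] Pxy nw Px Py th1 ph1 wP; rewrite leNgt; apply/negP => SM.
have [[x' y'] [Pq /= xx' yy']] := not_weak_frontier _ _ Pxy nw.
have ph0 r : 0 < phi 0 r by apply: lt_le_trans (ph1 r).
have eps0 r : 0 <= 1 - (phi 0 r)^-1 by rewrite subr_ge0 invf_le1.
have del0 i : 0 <= 1 - theta 0 i by rewrite subr_ge0.
pose w k := match k with
  | inl i => (1 - theta 0 i) / M
  | inr r => (1 - (phi 0 r)^-1) / M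
  end.
pose q (k : 'I_m + 'I_s) := match k with
  | inl i => (scale_at i (1 - M) x, y)
  | inr r => (x, scale_at r (1 - M)^-1 y)
  end.
pose W := \sum_k w k.
have w0 k : 0 <= w k by case: k => k /=; rewrite divr_ge0 // ltW.
have WE : W * M = \sum_i (1 - theta 0 i) + \sum_r (1 - (phi 0 r)^-1).
  by rewrite /W big_sumType /= -!mulr_suml -mulrDl divfK // gt_eqF.
have W1 : W < 1 by rewrite -(ltr_pM2r M0) WE mul1r.
have W0 : 0 <= W by apply: sumr_ge0.
have Pz := @convex_combination _ _ _ _ _ X Y rminus rplus _ w (x', y') q w0
  (ltW W1) Pq.
have {}Pz := Pz (fun k => match k return P (q k) with
  | inl i => Px i | inr r => Py r end).
apply: wP.2 Pz; apply/vlt_netted; rewrite -/W.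
have fstE i : (\sum_k w k *: q k).1 0 i
    = W * x 0 i + w (inl i) * ((1 - M) * x 0 i - x 0 i).
  rewrite (raddf_sum fst) summxE -weighted_sum_bump.
  apply: eq_bigr => -[i'|r] _.
    by rewrite /= !mxE eq_sym.
  by rewrite /= mxE.
have sndE r : (\sum_k w k *: q k).2 0 r
    = W * y 0 r + w (inr r) * ((1 - M)^-1 * y 0 r - y 0 r).
  rewrite (raddf_sum snd) summxE -weighted_sum_bump.
  apply: eq_bigr => -[i|r'] _.
    by rewrite /= mxE.
  by rewrite /= !mxE eq_sym.
have M1' : 0 < 1 - M by lra.
split=> k.
  rewrite [X in X < _]mxE fstE !mxE.
  have -> : w (inl k) = (1 - theta 0 k) / M by [].
  set a := (1 - theta 0 k) / M.
  have aM : a * M = 1 - theta 0 k by rewrite divfK // gt_eqF.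
  have := xx' k; nra.
rewrite [X in _ < X]mxE sndE !mxE.
have -> : w (inr k) = (1 - (phi 0 k)^-1) / M by [].
set a := (1 - (phi 0 k)^-1) / M.
have aM : a * M = 1 - (phi 0 k)^-1 by rewrite divfK // gt_eqF.
have yk : 0 <= y 0 k by have := y0 k; rewrite mxE.
have phM : phi 0 k <= (1 - M)^-1.
  rewrite -[phi 0 k]invrK lef_pV2 ?posrE ?invr_gt0 //.
  have : 1 - (phi 0 k)^-1 <= \sum_r (1 - (phi 0 r)^-1).
    by rewrite [leRHS](bigD1 k) //= lerDl sumr_ge0.
  have : 0 <= \sum_i (1 - theta 0 i) by rewrite sumr_ge0.
  lra.
(* Since phi - 1 = (1 - 1 / phi) phi and phi <= 1 / (1 - M), the linear
   interpolation up to the factor 1 / (1 - M) lies above phi. *)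
have step : phi 0 k * y 0 k <= y 0 k + a * ((1 - M)^-1 * y 0 k - y 0 k).
  have -> : a * ((1 - M)^-1 * y 0 k - y 0 k)
      = (1 - (phi 0 k)^-1) * (1 - M)^-1 * y 0 k.
    by rewrite -aM; field; rewrite gt_eqF.
  have : phi 0 k = 1 + (1 - (phi 0 k)^-1) * phi 0 k.
    by field; rewrite gt_eqF.
  have : (1 - (phi 0 k)^-1) * phi 0 k <= (1 - (phi 0 k)^-1) * (1 - M)^-1.
    exact: ler_wpM2l.
  nra.
have := yy' k; nra.
Qed.

End Efficiency.

(** * The Russell measure *)

Lemma output_expansionsE {R : realType} {m s : nat}
    (T : set ('rV[R]_m * 'rV[R]_s)) x y r :
  output_expansions T x y r = [set c | T (x, scale_at r c y)].
Proof.
apply/seteqP; split=> [c [phi [Tphi phi1 ->]]|c Tc] /=.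
  by rewrite -hprod_scale_at.
exists (factor_at r c); split; rewrite ?hprod_factor_at ?mxE ?eqxx //.
by move=> q /negPf qr; rewrite mxE qr.
Qed.

Lemma input_contractionsE {R : realType} {m s : nat}
    (T : set ('rV[R]_m * 'rV[R]_s)) x y i :
  input_contractions T x y i = [set c | T (scale_at i c x, y)].
Proof.
apply/seteqP; split=> [c [th [Tth th1 ->]]|c Tc] /=.
  by rewrite -hprod_scale_at.
exists (factor_at i c); split; rewrite ?hprod_factor_at ?mxE ?eqxx //.
by move=> q /negPf qr; rewrite mxE qr.
Qed.

(** The objective in terms of the defects 1 - theta_i and 1 - 1 / phi_r. *)
Lemma russell_objE {R : realType} {m s : nat} (theta : 'rV[R]_m)
    (phi : 'rV[R]_s) :
  russell_obj theta phi = ((m + s)%:R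
    - (\sum_i (1 - theta 0 i) + \sum_r (1 - (phi 0 r)^-1))) / (m + s)%:R.
Proof.
rewrite /russell_obj mulrC !sumrB !sumr_const !card_ord natrD; congr (_ / _).
ring.
Qed.

(** Meant for f the identity, on input factors, and f the inverse, on output
factors. *)
Lemma sum_factor_at_defect {R : realType} {d : nat} (k : 'I_d) (c : R)
    (f : R -> R) :
  f 1 = 1 -> \sum_i (1 - f ((factor_at k c) 0 i)) = 1 - f c.
Proof.
move=> f1; rewrite (bigD1 k) //= mxE eqxx big1 ?addr0 // => i /negPf ik.
by rewrite mxE ik f1 subrr.
Qed.

Lemma sum_const1_defect {R : realType} {d : nat} (f : R -> R) :
  f 1 = 1 -> \sum_i (1 - f ((const_mx 1 : 'rV[R]_d) 0 i)) = 0.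
Proof. by move=> f1; rewrite big1 // => i _; rewrite mxE f1 subrr. Qed.

Section Extrema.
Context {R : realType} {m s n K : nat}.
Variables (X : 'I_n -> 'rV[R]_m) (Y : 'I_n -> 'rV[R]_s).
Variables (rminus : 'I_K -> 'rV[R]_m) (rplus : 'I_K -> 'rV[R]_s).
Let P : set ('rV[R]_m * 'rV[R]_s) := tradeoff_polyhedron X Y rminus rplus.
Let T : set ('rV[R]_m * 'rV[R]_s) := vrs_to X Y rminus rplus.
Hypothesis P_proper : P <> setT.
Hypothesis P_frontiers : strong_frontier P = weak_frontier P.
Variables (x : 'rV[R]_m) (y : 'rV[R]_s).
Hypothesis xyT : T (x, y).

Let x0 : nonneg x. Proof. exact: xyT.2.1. Qed.
Let y0 : nonneg y. Proof. exact: xyT.2.2.1. Qed.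
Let xyP : P (x, y). Proof. exact: xyT.1. Qed.

(** Expanding an output cannot violate the sign constraints of T, so only
membership in P matters. *)
Lemma output_expansion_mem r c : 1 <= c ->
  P (x, scale_at r c y) -> T (x, scale_at r c y).
Proof.
move=> c1 Pc; split=> //; split=> //=.
have c0 : 0 <= c by apply: le_trans c1.
have [k yk] := semipos_coordinate _ xyT.2.2.
apply: (@semipos_of_coordinate _ _ _ k); first exact: scale_at_nonneg.
apply: lt_le_trans yk _; have := scale_at_le r 1 c y y0 c1 k.
by rewrite scale_at1.
Qed.

(** The largest expansion lands on the weak frontier: at a strictly dominated
point output r could still grow. *)
Lemma output_expansion_max r : 0 < y 0 r ->
  exists g, [/\ is_max (output_expansions T x y r) g, 1 <= g,
    T (x, scale_at r g y) & weak_frontier P (x, scale_at r g y)].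
Proof.
move=> yr; rewrite output_expansionsE.
pose d : 'rV[R]_m * 'rV[R]_s := (0, y 0 r *: delta_mx 0 r).
have sliceE h : (x, y) + h *: d = (x, scale_at r (1 + h) y).
  by rewrite -scale_at_slice; congr pair; rewrite /= scaler0 addr0.
have [||| B HB] := improving_direction_bounded X Y rminus rplus (x, y) d
  P_proper P_frontiers xyP.
- by move=> i.
- by move=> q; rewrite /= !mxE mulr_ge0 ?ler0n // ltW.
- move=> /(congr1 (fun z : 'rV[R]_m * 'rV[R]_s => z.2 0 r)).
  rewrite /= !mxE !eqxx mulr1 => yr0.
  by rewrite yr0 ltxx in yr.
have Pd0 : P ((x, y) + 0 *: d) by rewrite scale0r addr0.
have [h [Ph hmax]] := slice_has_max _ _ _ _ _ _ _ _ Pd0 HB.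
have h0 : 0 <= h by exact: hmax.
have Pg : P (x, scale_at r (1 + h) y) by rewrite -sliceE.
have gmax c : P (x, scale_at r c y) -> c <= 1 + h.
  move=> Pc; have : c - 1 <= h by apply: hmax; rewrite /= sliceE addrC subrK.
  lra.
have Tg : T (x, scale_at r (1 + h) y) by apply: output_expansion_mem => //; lra.
exists (1 + h); split=> //; last 1 first.
- apply: weak_frontier_undominated => // q Pq qx qy.
  have := qy r; rewrite mxE eqxx -ltr_pdivlMr // => lt_c.
  suff /gmax : P (x, scale_at r (q.2 0 r / y 0 r) y) by rewrite leNgt lt_c.
  apply: free_disposal Pq _ _ => k /=; first exact: ltW (qx k).
  rewrite mxE; case: eqP => [->|/eqP/negPf kr]; first by rewrite divfK ?gt_eqF.
  by have := qy k; rewrite mxE kr => /ltW.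
- by split=> // c [/gmax].
- by lra.
Qed.

(** A contraction stops either at the boundary of P or at 0, where the sign
constraint binds and the point may be interior to P. *)
Lemma input_contraction_min i : 0 < x 0 i ->
  exists t, [/\ is_min (input_contractions T x y i) t, 0 <= t <= 1,
    T (scale_at i t x, y)
    & 0 < t -> weak_frontier P (scale_at i t x, y)].
Proof.
move=> xi; rewrite input_contractionsE.
have memT c : 0 <= c -> P (scale_at i c x, y) -> T (scale_at i c x, y).
  move=> c0 Pc; split=> //; split=> /=; last exact: xyT.2.2.
  exact: scale_at_nonneg.
have nonnegT c : T (scale_at i c x, y) -> 0 <= c.
  by move=> [_ [/(_ i)]]; rewrite !mxE eqxx pmulr_lge0.
case: (pselect (P (scale_at i 0 x, y))) => [P0|nP0].
  exists 0; split=> //; rewrite ?ltxx ?lexx ?ler01 //; last exact: memT.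
  by split=> [|c /nonnegT //]; exact: memT.
pose d : 'rV[R]_m * 'rV[R]_s := (- (x 0 i *: delta_mx 0 i), 0).
have sliceE h : (x, y) + h *: d = (scale_at i (1 - h) x, y).
  rewrite -scale_at_slice; congr pair.
    by rewrite /= scalerN scaleNr.
  by rewrite /= scaler0 addr0.
have down a b : a <= b -> P (scale_at i a x, y) -> P (scale_at i b x, y).
  by move=> ab Pa; apply: free_disposal Pa _ _ => //=; exact: scale_at_le.
have HB : ubound [set h | P ((x, y) + h *: d)] 1.
  move=> h; rewrite /= sliceE => Ph; rewrite leNgt; apply/negP => h1.
  by apply/nP0/down/Ph; lra.
have Pd0 : P ((x, y) + 0 *: d) by rewrite scale0r addr0.
have [h [Ph hmax]] := slice_has_max _ _ _ _ _ _ _ _ Pd0 HB.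
have h0 : 0 <= h by exact: hmax.
have h1 : h <= 1 by exact: HB.
have Pt : P (scale_at i (1 - h) x, y) by rewrite -sliceE.
have tmin c : P (scale_at i c x, y) -> 1 - h <= c.
  move=> Pc; have : 1 - c <= h by apply: hmax; rewrite /= sliceE subKr.
  lra.
have Tt : T (scale_at i (1 - h) x, y) by apply: memT => //; lra.
exists (1 - h); split=> //.
- by split=> // c [/tmin].
- by apply/andP; split; lra.
move=> t0; apply: weak_frontier_undominated => // q Pq qx qy.
have := qx i; rewrite mxE eqxx -ltr_pdivrMr // => lt_c.
suff /tmin : P (scale_at i (q.1 0 i / x 0 i) x, y) by rewrite leNgt lt_c.
apply: free_disposal Pq _ _ => k /=; last exact: ltW (qy k).
rewrite mxE; case: eqP => [->|/eqP/negPf kr]; first by rewrite divfK ?gt_eqF.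
by have := qx k; rewrite mxE kr => /ltW.
Qed.

(** The last property holds also for outputs equal to 0, which no factor
changes; it is the form in which phi* enters the convexity argument. *)
Lemma phi_star_exists : exists phistar,
  [/\ is_phi_star T x y phistar, 1 <= phistar,
    exists2 r, T (x, scale_at r phistar y)
      & weak_frontier P (x, scale_at r phistar y)
    & forall r c, c <= phistar -> P (x, scale_at r c y)].
Proof.
have /choice[g gP] : forall r, exists g, 0 < y 0 r ->
    [/\ is_max (output_expansions T x y r) g, 1 <= g,
      T (x, scale_at r g y) & weak_frontier P (x, scale_at r g y)].
  move=> r.
  case: (ltP 0 (y 0 r)) => [/output_expansion_max[g ?]|_]; first by exists g.
  by exists 0.
have [r0 yr0] := semipos_coordinate _ xyT.2.2.
have [r yr rmin] := @arg_minP _ _ _ r0 (fun r => 0 < y 0 r) g yr0.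
have [gmax g1 Tg wg] := gP r yr.
exists (g r); split=> //.
- exists g; split=> [q /gP[]//|]; split; first by exists r.
  by move=> _ [q yq <-]; exact: rmin.
- by exists r.
move=> q c cg; case: (ltP 0 (y 0 q)) => [yq|yq]; last first.
  by rewrite scale_at_null //; apply/eqP; rewrite eq_le yq /=; have := y0 q;
     rewrite mxE.
have [_ _ [Pq _] _] := gP q yq.
apply: free_disposal Pq _ _ => //=; apply: scale_at_le => //.
exact: le_trans cg (rmin q yq).
Qed.

(** Either theta* is attained at a boundary point, or it is at most 1 / phi* and
does not influence the maximum; the latter covers x = 0, where theta* is
1 / phi* by convention, and theta* = 0. *)
Lemma theta_star_exists phistar : 1 <= phistar -> exists thetastar,
  [/\ is_theta_star T x y phistar thetastar,
    0 <= thetastar <= 1,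
    thetastar <= phistar^-1 \/ exists2 i, T (scale_at i thetastar x, y)
      & weak_frontier P (scale_at i thetastar x, y)
    & forall i c, thetastar <= c -> P (scale_at i c x, y)].
Proof.
move=> ph1; have ph0 : 0 < phistar by apply: lt_le_trans ph1.
have null i c : x 0 i <= 0 -> P (scale_at i c x, y).
  move=> xi; rewrite scale_at_null //; apply/eqP; rewrite eq_le xi /=.
  by have := x0 i; rewrite mxE.
rewrite /is_theta_star; case: asboolP => [supp0|supp].
  exists phistar^-1; split=> //; last 2 first.
  - by left.
  - move=> i c _; apply: null; rewrite leNgt; apply/negP => xi.
    by have : pos_support x i by []; rewrite supp0.
  - by rewrite invr_ge0 ltW //= invf_le1.
have /choice[g gP] : forall i, exists t, 0 < x 0 i ->
    [/\ is_min (input_contractions T x y i) t, 0 <= t <= 1,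
      T (scale_at i t x, y)
      & 0 < t -> weak_frontier P (scale_at i t x, y)].
  move=> i.
  case: (ltP 0 (x 0 i)) => [/input_contraction_min[t ?]|_]; first by exists t.
  by exists 0.
have [i0 xi0] : exists i, 0 < x 0 i.
  by have /eqP/set0P[i xi] := supp; exists i.
have [i xi imax] := @arg_maxP _ _ _ i0 (fun i => 0 < x 0 i) g xi0.
have [gmin g01 Tg wg] := gP i xi.
exists (g i); split=> //.
- exists g; split=> [q /gP[]//|]; split; first by exists i.
  by move=> _ [q xq <-]; exact: imax.
- case: (ltP 0 (g i)) => gi; first by right; exists i; last exact: wg.
  by left; apply: le_trans gi _; rewrite invr_ge0 ltW.
move=> q c cg; case: (ltP 0 (x 0 q)) => [xq|]; last exact: null.
have [_ _ [Pq _] _] := gP q xq.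
apply: free_disposal Pq _ _ => //=; apply: scale_at_le => //.
exact: le_trans (imax q xq) cg.
Qed.

End Extrema.

Theorem theorem4p3 (R : realType) (m s n K : nat)
    (m_gt0 : (0 < m)%N) (s_gt0 : (0 < s)%N)
    (n_gt0 : (0 < n)%N) (K_gt0 : (0 < K)%N)
    (X : 'I_n -> 'rV[R]_m) (Y : 'I_n -> 'rV[R]_s)
    (rminus : 'I_K -> 'rV[R]_m) (rplus : 'I_K -> 'rV[R]_s)
    (X_semipos : forall j, semipos (X j))
    (Y_semipos : forall j, semipos (Y j))
    (P_proper : tradeoff_polyhedron X Y rminus rplus <> setT)
    (P_frontiers : strong_frontier (tradeoff_polyhedron X Y rminus rplus)
                   = weak_frontier (tradeoff_polyhedron X Y rminus rplus))
    (x : 'rV[R]_m) (y : 'rV[R]_s)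
    (xyT : vrs_to X Y rminus rplus (x, y)) :
  exists phistar thetastar : R,
    [/\ is_phi_star (vrs_to X Y rminus rplus) x y phistar,
        is_theta_star (vrs_to X Y rminus rplus) x y phistar thetastar &
        is_max_russell (vrs_to X Y rminus rplus) x y
          (Num.max (((m + s)%:R - 1 + thetastar) / (m + s)%:R)
                   (((m + s)%:R - 1 + phistar^-1) / (m + s)%:R))].
Proof.
have [phistar [phiP ph1 [r0 Tr wr] Pphi]] :=
  phi_star_exists _ _ _ _ P_proper P_frontiers _ _ xyT.
have [thetastar [thetaP /andP[th0 th1] th_case Ptheta]] :=
  theta_star_exists _ _ _ _ _ _ xyT _ ph1.
exists phistar, thetastar; split=> //.
have ph0 : 0 < phistar by apply: lt_le_trans ph1.
have D0 : 0 < (m + s)%:R^-1 :> R by rewrite invr_gt0 ltr0n addn_gt0 m_gt0.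
have strong := weak_frontier_vrs_to X Y rminus rplus _ P_frontiers.
have phi_attained : max_russell_values (vrs_to X Y rminus rplus) x y
    (((m + s)%:R - 1 + phistar^-1) / (m + s)%:R).
  exists (const_mx 1), (factor_at r0 phistar); split.
  - by rewrite hprod1 hprod_factor_at; exact: strong.
  - by move=> i; rewrite mxE ler01 lexx.
  - by move=> r; rewrite mxE; case: ifP.
  rewrite russell_objE (sum_const1_defect id) //.
  rewrite (sum_factor_at_defect _ _ GRing.inv) ?invr1 //.
  by congr (_ / _); ring.
have theta_attained : phistar^-1 < thetastar ->
    max_russell_values (vrs_to X Y rminus rplus) x y
    (((m + s)%:R - 1 + thetastar) / (m + s)%:R).
  case: th_case => [le_th|[i0 Ti wi] _]; first by rewrite ltNge le_th.
  exists (factor_at i0 thetastar), (const_mx 1); split.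
  - by rewrite hprod1 hprod_factor_at; exact: strong.
  - by move=> i; rewrite mxE; case: ifP => _; rewrite ?th0 ?ler01 ?lexx.
  - by move=> r; rewrite mxE.
  rewrite russell_objE (sum_const1_defect GRing.inv) ?invr1 //.
  rewrite (sum_factor_at_defect _ _ id) //.
  by congr (_ / _); ring.
split.
  case: (ltP phistar^-1 thetastar) => th_ph.
    rewrite max_l; first exact: theta_attained.
    by rewrite ler_pM2r // lerD2l ltW.
  by rewrite max_r // ler_pM2r // lerD2l.
move=> _ [theta [phi [strong_p th01 phi1 ->]]].
have w := strong_frontier_vrs_to _ _ _ _ _ s_gt0 strong_p.
rewrite russell_objE leNgt gt_max !ltr_pM2r //.
apply/negP => /andP[lt_th lt_ph].
set S := (\sum_i _ + _) in lt_th lt_ph.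
have S0 : 0 <= S.
  apply: addr_ge0; apply: sumr_ge0 => k _; rewrite subr_ge0.
    by case/andP: (th01 k).
  by rewrite invf_le1 // (lt_le_trans _ (phi1 k)).
pose M := Num.min (1 - thetastar) (1 - phistar^-1).
have SM : S < M by rewrite /M lt_min; apply/andP; split; lra.
have Mth : thetastar <= 1 - M.
  have : M <= 1 - thetastar by rewrite ge_min lexx.
  lra.
have Mph' : phistar^-1 <= 1 - M.
  have : M <= 1 - phistar^-1 by rewrite ge_min lexx orbT.
  lra.
have phV0 : 0 < phistar^-1 by rewrite invr_gt0.
have Mph : (1 - M)^-1 <= phistar.
  by rewrite -[phistar]invrK lef_pV2 ?posrE //; lra.
suff : M <= S by rewrite leNgt SM.
apply: (single_moves_bound X Y rminus rplus M x y theta phi) => //.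
- exact: xyT.2.2.1.
- by apply/andP; split; lra.
- exact: xyT.1.
(* As M > 0, some positive output of (x, y) can be expanded inside P. *)
- rewrite -P_frontiers => xy_strong.
  have [k yk] := semipos_coordinate _ xyT.2.2.
  have [y0 _] := xyT.2.2.
  have gt1 : 1 < (1 - M)^-1 by rewrite invf_gt1; lra.
  have le_y : vle y (scale_at k (1 - M)^-1 y).
    by have := scale_at_le k _ _ y y0 (ltW gt1); rewrite scale_at1.
  have := strong_frontier_undominated _ _ _ xy_strong (Pphi k _ Mph)
    (fun=> lexx _) le_y.
  move/(congr1 (fun z : 'rV[R]_m * 'rV[R]_s => z.2 0 k)).
  rewrite /= mxE eqxx => eqk.
  have : y 0 k < (1 - M)^-1 * y 0 k by rewrite ltr_pMl.
  by rewrite eqk ltxx.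
- by move=> i; exact: Ptheta.
- by move=> r; exact: Pphi.
- by move=> i; case/andP: (th01 i).
Qed.
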